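(* Let $G$ be a groupoid, let $A$ be a ring and let $\sigma=(A_g,\sigma_g)_{g\in G}$ be a global action of $G$ on $A$ such that $A_e$ is $s$-unital for every $e\in G_0$, and let $A=\oplus_{e\in G_0}A_e$. Let $G_0':=\{e\in G_0: A_e\neq\{0\}\}$. Suppose that the groupoid $G$ is connected. Then the skew groupoid ring $A\rtimes_\sigma G$ is prime if, and only if, there is some $e\in G_0'$ such that $A_e\rtimes_{\sigma^e}G_e^e$ is prime.
   Context: All rings are associative but not necessarily unital; ideals are two-sided. A ring is prime if it has no nonzero ideals $I,J$ with $IJ=\{0\}$. A ring $R$ is $s$-unital if for every $x\in R$ there are $a,b\in R$ with $ax=x=xb$. A groupoid $G$ is a small category in which every morphism is invertible; $G$ also denotes its set of morphisms. Objects are identified with identity morphisms, so the set of objects $G_0$ is a subset of $G$. The maps $s,r:G\to G_0$ are source and range; $gh$ is defined iff $s(g)=r(h)$. $G$ is connected if for all $e,f\in G_0$ there is $g\in G$ with $s(g)=e$ and $r(g)=f$. For $e\in G_0$, $G_e^e:=\{g\in G: s(g)=r(g)=e\}$. A partial action of $G$ on a ring $A$ is a family $\sigma=(A_g,\sigma_g)_{g\in G}$ such that: (i) for each $g\in G$, $A_{r(g)}$ is an ideal of $A$, $A_g$ is an ideal of $A_{r(g)}$, and $\sigma_g:A_{g^{-1}}\to A_g$ is a ring isomorphism; (ii) $\sigma_e=\mathrm{id}_{A_e}$ for $e\in G_0$; (iii) $\sigma_h^{-1}(A_{g^{-1}}\cap A_h)\subseteq A_{(gh)^{-1}}$ whenever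 $s(g)=r(h)$; (iv) $\sigma_g(\sigma_h(x))=\sigma_{gh}(x)$ for all $x\in\sigma_h^{-1}(A_{g^{-1}}\cap A_h)$ whenever $s(g)=r(h)$. The partial action is global if $A_g=A_{r(g)}$ for every $g\in G$; then $\sigma_g:A_{s(g)}\to A_{r(g)}$ is a ring isomorphism and $\sigma_g\circ\sigma_h=\sigma_{gh}$ whenever $s(g)=r(h)$. Here $A=\oplus_{e\in G_0}A_e$ means that $A$ is the internal direct sum of the ideals $A_e$. The skew groupoid ring $A\rtimes_\sigma G$ is the set of formal sums $\sum_{g\in G}a_g\delta_g$ with $a_g\in A_g=A_{r(g)}$ zero for all but finitely many $g$, with pointwise addition and multiplication determined by $(a\delta_g)(b\delta_h)=a\sigma_g(b)\delta_{gh}$ if $s(g)=r(h)$, and $0$ otherwise. For $e\in G_0$, $\sigma^e:=(A_h,\sigma_h)_{h\in G_e^e}$ is the restricted action of the group $G_e^e$ on $A_e$, and $A_e\rtimes_{\sigma^e}G_e^e$ is the associated skew group ring.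
   Formalization: A prime ring is required to be nonzero; under the definition without this clause the claim fails for A = {0}, where the zero skew groupoid ring is vacuously prime but G_0' is empty; for A ≠ {0} the statement is unchanged. *)

(* Defs.v *)
From HB Require Import structures.
From mathcomp Require Import all_boot all_order all_algebra.
From mathcomp Require Import finmap.
From mathcomp Require Import boolp classical_sets functions.
From mathcomp.multinomials Require Import monalg.

Set Implicit Arguments.
Unset Strict Implicit.
Unset Printing Implicit Defensive.

Import GRing.Theory.

Local Open Scope classical_set_scope.
Local Open Scope ring_scope.

Notation "x ** y" := (@monoid.mul _ x%R y%R)
  (at level 40, left associativity) : ring_scope.

HB.mixin Record Zmodule_Semigroup_isRng R
    of GRing.Zmodule R & Semigroup R := {
  rmulDl : forall x y z : R, (x + y) ** z = x ** z + y ** z;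
  rmulDr : forall x y z : R, x ** (y + z) = x ** y + x ** z
}.

#[short(type="rngType")]
HB.structure Definition Rng :=
  { R of GRing.Zmodule R & Semigroup R & Zmodule_Semigroup_isRng R }.

Section RngTheory.
Variable R : rngType.
Implicit Types (x y z : R) (I J : set R).

Lemma rmulA x y z : x ** (y ** z) = x ** y ** z.
Proof. exact: mulgA. Qed.

Lemma rmul0l x : 0 ** x = 0.
Proof. by apply: (addrI (0 ** x)); rewrite -rmulDl !addr0. Qed.

Lemma rmul0r x : x ** 0 = 0.
Proof. by apply: (addrI (x ** 0)); rewrite -rmulDr !addr0. Qed.

Definition additive_subgroup I : Prop :=
  I 0 /\ forall x y, I x -> I y -> I (x - y).

Definition ideal_of J I : Prop :=
  [/\ I `<=` J, additive_subgroup I &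
      forall r x, J r -> I x -> I (r ** x) /\ I (x ** r)].

Definition is_ideal I : Prop := ideal_of setT I.

Definition ideal_prod I J : set R :=
  [set x | exists (n : nat) (a b : 'I_n -> R),
     [/\ forall i, I (a i), forall i, J (b i) & x = \sum_(i < n) a i ** b i]].

Definition nonzero_ring : Prop := exists x : R, x <> 0.

(* A prime ring is nonzero by convention.  Without this clause the zero ring
   would be prime, having no nonzero ideal at all. *)
Definition prime_ring : Prop :=
  nonzero_ring /\
  ~ exists I J : set R, [/\ is_ideal I, is_ideal J, I <> [set 0], J <> [set 0]
                          & ideal_prod I J = [set 0]].

Definition s_unital : Prop :=
  forall x, exists a b, a ** x = x /\ x = x ** b.

End RngTheory.

Arguments nonzero_ring R : clear implicits.
Arguments prime_ring R : clear implicits.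
Arguments s_unital R : clear implicits.

Definition ring_iso_on (R : rngType) (I J : set R) (f : R -> R) : Prop :=
  [/\ set_bij I J f,
      forall x y, I x -> I y -> f (x + y) = f x + f y &
      forall x y, I x -> I y -> f (x ** y) = f x ** f y].

Record ideal (R : rngType) := Ideal {
  ideal_set : set R;
  ideal_setP : is_ideal ideal_set
}.

Definition ideal_pred (R : rngType) (I : ideal R) : {pred R} :=
  fun x => `[< ideal_set I x >].

Lemma ideal_zmod_closed (R : rngType) (I : ideal R) : zmod_closed (ideal_pred I).
Proof.
have [_ [I0 IB] _] := ideal_setP I.
split; first exact/asboolP.
by move=> x y /asboolP Ix /asboolP Iy; apply/asboolP; apply: IB.
Qed.

HB.instance Definition _ (R : rngType) (I : ideal R) :=
  GRing.isZmodClosed.Build R (ideal_pred I) (ideal_zmod_closed I).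

Section IdealRing.
Variables (R : rngType) (I : ideal R).

Record ideal_ring : predArgType := IdealRing {
  ideal_val :> R;
  ideal_valP : ideal_val \in ideal_pred I
}.

HB.instance Definition _ := [isSub for ideal_val].
HB.instance Definition _ := [Choice of ideal_ring by <:].
HB.instance Definition _ := [SubChoice_isSubZmodule of ideal_ring by <:].

Lemma ideal_ringP (x : ideal_ring) : ideal_set I (val x).
Proof. exact/asboolP/ideal_valP. Qed.

Lemma ideal_mul_subproof (x y : ideal_ring) : val x ** val y \in ideal_pred I.
Proof.
have [_ _ Im] := ideal_setP I; apply/asboolP.
by have [] := Im (val x) (val y) Logic.I (ideal_ringP y).
Qed.

Definition ideal_mul (x y : ideal_ring) : ideal_ring :=
  IdealRing (ideal_mul_subproof x y).

Lemma ideal_mulA : associative ideal_mul.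
Proof. by move=> x y z; apply: val_inj; apply: rmulA. Qed.

HB.instance Definition _ := isSemigroup.Build ideal_ring ideal_mulA.

Lemma ideal_mulDl (x y z : ideal_ring) : (x + y) ** z = x ** z + y ** z.
Proof. by apply: val_inj; apply: rmulDl. Qed.

Lemma ideal_mulDr (x y z : ideal_ring) : x ** (y + z) = x ** y + x ** z.
Proof. by apply: val_inj; apply: rmulDr. Qed.

HB.instance Definition _ :=
  Zmodule_Semigroup_isRng.Build ideal_ring ideal_mulDl ideal_mulDr.

End IdealRing.

(* One-sorted: an object is identified with its identity morphism.  The total
   function [gcomp] is only meaningful when [gsrc g = gtgt h]; [gcomp g h] is
   g after h. *)
HB.mixin Record isGroupoid G of Choice G := {
  gsrc : G -> G;
  gtgt : G -> G;
  gcomp : G -> G -> G;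
  ginv : G -> G;
  gsrc_src : forall g, gsrc (gsrc g) = gsrc g;
  gtgt_src : forall g, gtgt (gsrc g) = gsrc g;
  gsrc_tgt : forall g, gsrc (gtgt g) = gtgt g;
  gtgt_tgt : forall g, gtgt (gtgt g) = gtgt g;
  gsrc_comp : forall g h, gsrc g = gtgt h -> gsrc (gcomp g h) = gsrc h;
  gtgt_comp : forall g h, gsrc g = gtgt h -> gtgt (gcomp g h) = gtgt g;
  gcompA : forall g h k, gsrc g = gtgt h -> gsrc h = gtgt k ->
    gcomp g (gcomp h k) = gcomp (gcomp g h) k;
  gcomp_src : forall g, gcomp g (gsrc g) = g;
  gcomp_tgt : forall g, gcomp (gtgt g) g = g;
  gsrc_inv : forall g, gsrc (ginv g) = gtgt g;
  gtgt_inv : forall g, gtgt (ginv g) = gsrc g;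
  gcompVg : forall g, gcomp (ginv g) g = gsrc g;
  gcompgV : forall g, gcomp g (ginv g) = gtgt g
}.

#[short(type="groupoidType")]
HB.structure Definition Groupoid := { G of isGroupoid G & Choice G }.

Definition is_object (G : groupoidType) : pred G := fun e => gsrc e == e.
Arguments is_object {G} e.

Definition object (G : groupoidType) := {e : G | is_object e}.

Lemma object_src (G : groupoidType) (e : object G) : gsrc (val e) = val e.
Proof. exact/eqP/(valP e). Qed.

Lemma object_tgt (G : groupoidType) (e : object G) : gtgt (val e) = val e.
Proof. by rewrite -{1}object_src gtgt_src object_src. Qed.

Definition connected_groupoid (G : groupoidType) : Prop :=
  forall e f : object G, exists g : G, gsrc g = val e /\ gtgt g = val f.

(* The isotropy group at [e] is represented as a one-object groupoid, so that the
   skew group ring of the restricted action is a [skew_ring]. *)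
Section Isotropy.
Variables (G : groupoidType) (e : object G).

Definition in_isotropy : pred G :=
  fun g => (gsrc g == val e) && (gtgt g == val e).

Record isotropy : predArgType := Isotropy {
  iso_val :> G;
  iso_valP : in_isotropy iso_val
}.

HB.instance Definition _ := [isSub for iso_val].
HB.instance Definition _ := [Choice of isotropy by <:].

Implicit Types g h k : isotropy.

Lemma iso_src g : gsrc (val g) = val e.
Proof. by have /andP[/eqP] := iso_valP g. Qed.

Lemma iso_tgt g : gtgt (val g) = val e.
Proof. by have /andP[_ /eqP] := iso_valP g. Qed.

Lemma iso_srctgt g h : gsrc (val g) = gtgt (val h).
Proof. by rewrite iso_src iso_tgt. Qed.

Lemma iso_src_subproof g : in_isotropy (gsrc (val g)).
Proof. by rewrite /in_isotropy gsrc_src gtgt_src iso_src eqxx. Qed.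

Lemma iso_tgt_subproof g : in_isotropy (gtgt (val g)).
Proof. by rewrite /in_isotropy gsrc_tgt gtgt_tgt iso_tgt eqxx. Qed.

Lemma iso_comp_subproof g h : in_isotropy (gcomp (val g) (val h)).
Proof.
rewrite /in_isotropy gsrc_comp ?gtgt_comp; try exact: iso_srctgt.
by rewrite iso_src iso_tgt eqxx.
Qed.

Lemma iso_inv_subproof g : in_isotropy (ginv (val g)).
Proof. by rewrite /in_isotropy gsrc_inv gtgt_inv iso_src iso_tgt eqxx. Qed.

Definition isoS g := Isotropy (iso_src_subproof g).
Definition isoT g := Isotropy (iso_tgt_subproof g).
Definition isoM g h := Isotropy (iso_comp_subproof g h).
Definition isoV g := Isotropy (iso_inv_subproof g).

Lemma isoSS g : isoS (isoS g) = isoS g.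
Proof. exact/val_inj/gsrc_src. Qed.
Lemma isoTS g : isoT (isoS g) = isoS g.
Proof. exact/val_inj/gtgt_src. Qed.
Lemma isoST g : isoS (isoT g) = isoT g.
Proof. exact/val_inj/gsrc_tgt. Qed.
Lemma isoTT g : isoT (isoT g) = isoT g.
Proof. exact/val_inj/gtgt_tgt. Qed.
Lemma isoSM g h : isoS g = isoT h -> isoS (isoM g h) = isoS h.
Proof. by move=> _; apply/val_inj/gsrc_comp/iso_srctgt. Qed.
Lemma isoTM g h : isoS g = isoT h -> isoT (isoM g h) = isoT g.
Proof. by move=> _; apply/val_inj/gtgt_comp/iso_srctgt. Qed.
Lemma isoMA g h k : isoS g = isoT h -> isoS h = isoT k ->
  isoM g (isoM h k) = isoM (isoM g h) k.
Proof. by move=> _ _; apply/val_inj/gcompA; apply: iso_srctgt. Qed.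
Lemma isoMS g : isoM g (isoS g) = g.
Proof. exact/val_inj/gcomp_src. Qed.
Lemma isoTMg g : isoM (isoT g) g = g.
Proof. exact/val_inj/gcomp_tgt. Qed.
Lemma isoSV g : isoS (isoV g) = isoT g.
Proof. exact/val_inj/gsrc_inv. Qed.
Lemma isoTV g : isoT (isoV g) = isoS g.
Proof. exact/val_inj/gtgt_inv. Qed.
Lemma isoVM g : isoM (isoV g) g = isoS g.
Proof. exact/val_inj/gcompVg. Qed.
Lemma isoMV g : isoM g (isoV g) = isoT g.
Proof. exact/val_inj/gcompgV. Qed.

HB.instance Definition _ := isGroupoid.Build isotropy
  isoSS isoTS isoST isoTT isoSM isoTM isoMA isoMS isoTMg isoSV isoTV isoVM isoMV.

End Isotropy.

(* [act g] is a total function on [A]; only its restriction to [dom (ginv g)]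
   is constrained, and only that restriction is ever used. *)
Record partialAction (G : groupoidType) (A : rngType) := PartialAction {
  dom : G -> set A;
  act : G -> A -> A;
  dom_tgt_ideal : forall g, is_ideal (dom (gtgt g));
  dom_ideal : forall g, ideal_of (dom (gtgt g)) (dom g);
  act_iso : forall g, ring_iso_on (dom (ginv g)) (dom g) (act g);
  act_object : forall e, is_object e -> forall x, dom e x -> act e x = x;
  dom_comp : forall g h, gsrc g = gtgt h -> forall x,
    dom (ginv h) x -> (dom (ginv g) `&` dom h) (act h x) ->
    dom (ginv (gcomp g h)) x;
  act_comp : forall g h, gsrc g = gtgt h -> forall x,
    dom (ginv h) x -> (dom (ginv g) `&` dom h) (act h x) ->
    act g (act h x) = act (gcomp g h) x
}.

Record globalAction (G : groupoidType) (A : rngType) := GlobalAction {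
  global_partial :> partialAction G A;
  dom_global : forall g, dom global_partial g = dom global_partial (gtgt g)
}.

Section GlobalTheory.
Variables (G : groupoidType) (A : rngType) (s : globalAction G A).
Implicit Types (g h k : G) (x y : A).

Lemma dom_is_ideal g : is_ideal (dom s g).
Proof. rewrite dom_global; exact: dom_tgt_ideal. Qed.

Lemma dom0 g : dom s g 0.
Proof. by have [_ []] := dom_is_ideal g. Qed.

Lemma domB g x y : dom s g x -> dom s g y -> dom s g (x - y).
Proof. by have [_ [_ dB] _] := dom_is_ideal g; apply: dB. Qed.

Lemma domN g x : dom s g x -> dom s g (- x).
Proof. by rewrite -[- x]add0r; apply: domB; apply: dom0. Qed.

Lemma domD g x y : dom s g x -> dom s g y -> dom s g (x + y).
Proof. by move=> dx dy; rewrite -[y]opprK; apply: domB => //; apply: domN. Qed.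

Lemma domMl g x y : dom s g x -> dom s g (y ** x).
Proof. by have [_ _ dM] := dom_is_ideal g => /(dM y x Logic.I)[]. Qed.

Lemma domMr g x y : dom s g x -> dom s g (x ** y).
Proof. by have [_ _ dM] := dom_is_ideal g => /(dM y x Logic.I)[]. Qed.

Lemma dom_inv g : dom s (ginv g) = dom s (gsrc g).
Proof. by rewrite dom_global gtgt_inv. Qed.

Lemma dom_tgt g h : gtgt g = gtgt h -> dom s g = dom s h.
Proof. by rewrite dom_global (dom_global _ h) => ->. Qed.

Lemma dom_srctgt g h : gsrc g = gtgt h -> dom s (ginv g) = dom s h.
Proof. by rewrite dom_inv (dom_global _ h) => ->. Qed.

Lemma act_dom g x : dom s (ginv g) x -> dom s g (act s g x).
Proof. by have [[aS _ _] _ _] := act_iso s g; apply: aS. Qed.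

Lemma actD g x y : dom s (ginv g) x -> dom s (ginv g) y ->
  act s g (x + y) = act s g x + act s g y.
Proof. by have [_ aD _] := act_iso s g; apply: aD. Qed.

Lemma actM g x y : dom s (ginv g) x -> dom s (ginv g) y ->
  act s g (x ** y) = act s g x ** act s g y.
Proof. by have [_ _ aM] := act_iso s g; apply: aM. Qed.

Lemma act0 g : act s g 0 = 0.
Proof. by apply: (addrI (act s g 0)); rewrite -actD ?addr0 //; apply: dom0. Qed.

Lemma actA g h x : gsrc g = gtgt h -> dom s (ginv h) x ->
  act s g (act s h x) = act s (gcomp g h) x.
Proof.
move=> gh dx; apply: act_comp => //; split; last exact: act_dom.
by rewrite (dom_srctgt gh); apply: act_dom.
Qed.

Lemma dom_object_ideal (e : object G) : is_ideal (dom s (val e)).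
Proof. exact: dom_is_ideal. Qed.

Definition component (e : object G) : ideal A := Ideal (dom_object_ideal e).

(* [A] is the internal direct sum of the [A_e]: every [a : A] is, in a unique
   way, the sum of a finitely supported family [c] indexed by [G_0] with
   [c e] in [A_e].  The family is extended by 0 to [G]. *)
Definition internal_direct_sum : Prop :=
  forall a : A, exists! c : {malg A[G]},
    [/\ forall e : object G, dom s (val e) c@_(val e),
        forall g : G, ~~ is_object g -> c@_g = 0 &
        a = \sum_(e <- msupp c) c@_e].

End GlobalTheory.

Section SkewDef.
Variables (G : groupoidType) (A : rngType) (s : globalAction G A).

(* [{malg A[G]}] is the group of finitely supported families of elements of
   [A] indexed by [G], [x@_g] is the coefficient of [x] at [g], and
   [<< a *g g >>] is the family [a delta_g]. *)
Definition skew_pred : {pred {malg A[G]}} :=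
  fun x => `[< forall g, dom s g x@_g >].

Lemma skewP (x : {malg A[G]}) : reflect (forall g, dom s g x@_g) (x \in skew_pred).
Proof. exact: asboolP. Qed.

Definition skew_prod (x y : {malg A[G]}) : {malg A[G]} :=
  \sum_(g <- msupp x) \sum_(h <- msupp y)
    (if gsrc g == gtgt h then << x@_g ** act s g y@_h *g gcomp g h >> else 0).

Lemma skew_zmod_closed : zmod_closed skew_pred.
Proof.
split; first by apply/skewP => g; rewrite mcoeff0; apply: dom0.
move=> x y /skewP dx /skewP dy; apply/skewP => g.
by rewrite mcoeffB; apply: domB.
Qed.

HB.instance Definition _ :=
  GRing.isZmodClosed.Build {malg A[G]} skew_pred skew_zmod_closed.

Record skew_ring : predArgType := SkewRing {
  skew_val :> {malg A[G]};
  skew_valP : skew_val \in skew_pred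
}.

HB.instance Definition _ := [isSub for skew_val].
HB.instance Definition _ := [Choice of skew_ring by <:].
HB.instance Definition _ := [SubChoice_isSubZmodule of skew_ring by <:].

Implicit Types (x y z : {malg A[G]}) (g h k : G).

Lemma skew_monoP g a : dom s g a -> << a *g g >> \in skew_pred.
Proof.
move=> da; apply/skewP => h; rewrite mcoeffU.
by case: eqP => [<-//|_]; rewrite mulr0n; apply: dom0.
Qed.

Definition skew_term x y g h : {malg A[G]} :=
  if gsrc g == gtgt h then << x@_g ** act s g y@_h *g gcomp g h >> else 0.

Lemma skew_prodEw x y (X Y : {fset G}) :
  (msupp x `<=` X)%fset -> (msupp y `<=` Y)%fset ->
  skew_prod x y = \sum_(g <- X) \sum_(h <- Y) skew_term x y g h.
Proof.
move=> sX sY; rewrite /skew_prod (big_fset_incl _ sX) /=; last first.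
  move=> g _ /mcoeff_outdom xg; rewrite big1 // => h _.
  by rewrite xg rmul0l monalgU0 if_same.
apply: eq_bigr => g _; rewrite (big_fset_incl _ sY) //.
by move=> h _ /mcoeff_outdom yh; rewrite yh act0 rmul0r monalgU0 if_same.
Qed.

Lemma skew_prod_closed x y :
  x \in skew_pred -> y \in skew_pred -> skew_prod x y \in skew_pred.
Proof.
move=> /skewP dx /skewP dy; apply: rpred_sum => g _; apply: rpred_sum => h _.
case: eqP => [gh|_]; last exact: rpred0.
apply: skew_monoP; rewrite (@dom_tgt _ _ s _ g) ?gtgt_comp //.
by apply: domMr.
Qed.

Lemma skew_prodDl x y z : skew_prod (x + y) z = skew_prod x z + skew_prod y z.
Proof.
pose X := (msupp x `|` msupp y)%fset.
rewrite (@skew_prodEw (x + y) z X (msupp z)) ?msuppD_le ?fsubset_refl //.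
rewrite (@skew_prodEw x z X (msupp z)) ?fsubsetUl ?fsubset_refl //.
rewrite (@skew_prodEw y z X (msupp z)) ?fsubsetUr ?fsubset_refl //.
rewrite -big_split; apply: eq_bigr => g _ /=; rewrite -big_split.
apply: eq_bigr => h _ /=; rewrite /skew_term; case: eqP; last by rewrite addr0.
by move=> _; rewrite mcoeffD rmulDl monalgUD.
Qed.

Lemma skew_prodDr x y z : y \in skew_pred -> z \in skew_pred ->
  skew_prod x (y + z) = skew_prod x y + skew_prod x z.
Proof.
move=> /skewP dy /skewP dz; pose Y := (msupp y `|` msupp z)%fset.
rewrite (@skew_prodEw x (y + z) (msupp x) Y) ?msuppD_le ?fsubset_refl //.
rewrite (@skew_prodEw x y (msupp x) Y) ?fsubsetUl ?fsubset_refl //.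
rewrite (@skew_prodEw x z (msupp x) Y) ?fsubsetUr ?fsubset_refl //.
rewrite -big_split; apply: eq_bigr => g _ /=; rewrite -big_split.
apply: eq_bigr => h _ /=; rewrite /skew_term; case: eqP; last by rewrite addr0.
by move=> gh; rewrite mcoeffD actD ?(dom_srctgt _ gh) // rmulDr monalgUD.
Qed.

Lemma skew_prodU a b g h :
  skew_prod << a *g g >> << b *g h >> =
  if gsrc g == gtgt h then << a ** act s g b *g gcomp g h >> else 0.
Proof.
rewrite (@skew_prodEw _ _ [fset g]%fset [fset h]%fset) ?msuppU_le //.
by rewrite !big_seq_fset1 /skew_term !mcoeffUU.
Qed.

Lemma skew_prod0l x : skew_prod 0 x = 0.
Proof. by rewrite /skew_prod msupp0 big_seq_fset0. Qed.

Lemma skew_prod0r x : skew_prod x 0 = 0.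
Proof.
by rewrite /skew_prod big1 // => g _; rewrite msupp0 big_seq_fset0.
Qed.

Lemma skew_ind (P : {malg A[G]} -> Prop) :
  P 0 -> (forall g a y, dom s g a -> y \in skew_pred -> P y -> P (<< a *g g >> + y)) ->
  forall x, x \in skew_pred -> P x.
Proof.
move=> P0 PD x /skewP dx; rewrite [x]monalgE.
suff H (r : seq G) : let y := \sum_(k <- r) << x@_k *g k >> in
    y \in skew_pred /\ P y by case: (H (msupp x)).
elim: r => [|g r [IH1 IH2]] /=; first by rewrite big_nil; split=> //; apply: rpred0.
rewrite big_cons; split; last exact: PD.
by apply: rpredD => //; apply: skew_monoP.
Qed.

Lemma skew_prodA x y z :
  x \in skew_pred -> y \in skew_pred -> z \in skew_pred ->
  skew_prod x (skew_prod y z) = skew_prod (skew_prod x y) z.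
Proof.
move=> sx sy sz.
elim/skew_ind: x / sx => [|g a x da sx IHx]; first by rewrite !skew_prod0l.
rewrite !skew_prodDl IHx; congr (_ + _) => {x sx IHx}.
elim/skew_ind: y / sy => [|h b y db sy IHy].
  by rewrite !(skew_prod0l, skew_prod0r).
have smb := skew_monoP db.
rewrite skew_prodDl !skew_prodDr // ?skew_prodDl ?IHy; try exact: skew_prod_closed.
congr (_ + _) => {y sy IHy}.
elim/skew_ind: z / sz => [|k c z dc sz IHz]; first by rewrite !skew_prod0r.
have smc := skew_monoP dc.
rewrite !skew_prodDr ?IHz //; try exact: skew_prod_closed.
congr (_ + _) => {z sz IHz}.
rewrite !skew_prodU; have [hk|hk] := eqVneq (gsrc h) (gtgt k); last first.
  rewrite skew_prod0r; have [gh|gh] := eqVneq (gsrc g) (gtgt h); last first.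
    by rewrite skew_prod0l.
  by rewrite skew_prodU gsrc_comp // (negbTE hk).
have [gh|gh] := eqVneq (gsrc g) (gtgt h); last first.
  by rewrite skew_prod0l skew_prodU gtgt_comp // (negbTE gh).
rewrite !skew_prodU gtgt_comp // gsrc_comp // gh hk !eqxx gcompA //.
have dc' : dom s (ginv h) c by rewrite (dom_srctgt _ hk).
have dac := act_dom dc'.
by rewrite actM ?(dom_srctgt _ gh) // actA // rmulA.
Qed.

Definition skew_mul (x y : skew_ring) : skew_ring :=
  SkewRing (skew_prod_closed (skew_valP x) (skew_valP y)).

Lemma skew_mulA : associative skew_mul.
Proof. by move=> x y z; apply/val_inj/skew_prodA; apply: skew_valP. Qed.

HB.instance Definition _ := isSemigroup.Build skew_ring skew_mulA.

Lemma skew_mulDl (x y z : skew_ring) : (x + y) ** z = x ** z + y ** z.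
Proof. exact/val_inj/skew_prodDl. Qed.

Lemma skew_mulDr (x y z : skew_ring) : x ** (y + z) = x ** y + x ** z.
Proof. by apply/val_inj/skew_prodDr; apply: skew_valP. Qed.

HB.instance Definition _ :=
  Zmodule_Semigroup_isRng.Build skew_ring skew_mulDl skew_mulDr.

End SkewDef.

Section Restriction.
Variables (G : groupoidType) (A : rngType) (s : globalAction G A).
Variable e : object G.

Local Notation Ae := (ideal_ring (component s e)).
Implicit Types (g h : isotropy e) (x y : Ae).

Lemma iso_dom g : dom s (val g) = dom s (val e).
Proof. by apply: dom_tgt; rewrite iso_tgt object_tgt. Qed.

Lemma iso_domV g : dom s (ginv (val g)) = dom s (val e).
Proof. by apply: dom_srctgt; rewrite iso_src object_tgt. Qed.

Lemma Ae_dom x : dom s (val e) (val x).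
Proof. exact: ideal_ringP. Qed.

Definition res_dom g : set Ae := [set x | dom s (val g) (val x)].

Lemma res_act_subproof g x : act s (val g) (val x) \in ideal_pred (component s e).
Proof.
apply/asboolP; rewrite /= -(iso_dom g); apply: act_dom.
by rewrite iso_domV; apply: Ae_dom.
Qed.

Definition res_act g x : Ae := IdealRing (res_act_subproof g x).

Lemma res_domT g : res_dom g = setT.
Proof. by apply/seteqP; split=> // x _; rewrite /res_dom /= iso_dom; apply: Ae_dom. Qed.

Lemma res_tgt_ideal g : is_ideal (res_dom (gtgt g)).
Proof. by rewrite res_domT; do !split. Qed.

Lemma res_ideal g : ideal_of (res_dom (gtgt g)) (res_dom g).
Proof. by rewrite !res_domT; do !split. Qed.

Lemma res_iso g : ring_iso_on (res_dom (ginv g)) (res_dom g) (res_act g).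
Proof.
rewrite !res_domT; have [[_ inj sur] aD aM] := act_iso s (val g).
rewrite !iso_domV !iso_dom in inj sur aD aM.
split; last 2 first.
- by move=> x y _ _; apply: val_inj; apply: aD; apply: Ae_dom.
- by move=> x y _ _; apply: val_inj; apply: aM; apply: Ae_dom.
split=> //.
- move=> x y _ _ /(congr1 val) /= exy; apply: val_inj.
  by apply: inj => //; apply/mem_set/Ae_dom.
- move=> y _; have [x dx xy] := sur (val y) (Ae_dom y).
  have xI : x \in ideal_pred (component s e) by apply/asboolP.
  by exists (IdealRing xI) => //; apply: val_inj.
Qed.

Lemma res_object g : is_object g -> forall x, res_dom g x -> res_act g x = x.
Proof.
move=> /eqP/(congr1 val) og x gx; apply: val_inj.
by apply: act_object gx; apply/eqP.
Qed.

Lemma res_dom_comp g h : gsrc g = gtgt h -> forall x,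
  res_dom (ginv h) x -> (res_dom (ginv g) `&` res_dom h) (res_act h x) ->
  res_dom (ginv (gcomp g h)) x.
Proof. by move=> *; rewrite res_domT. Qed.

Lemma res_act_comp g h : gsrc g = gtgt h -> forall x,
  res_dom (ginv h) x -> (res_dom (ginv g) `&` res_dom h) (res_act h x) ->
  res_act g (res_act h x) = res_act (gcomp g h) x.
Proof.
move=> _ x dx _; apply: val_inj; apply: actA; first exact: iso_srctgt.
exact: dx.
Qed.

Definition res_partial : partialAction (isotropy e) Ae :=
  PartialAction res_tgt_ideal res_ideal res_iso res_object res_dom_comp res_act_comp.

Lemma res_global g : dom res_partial g = dom res_partial (gtgt g).
Proof. by rewrite /= !res_domT. Qed.

Definition restriction : globalAction (isotropy e) Ae := GlobalAction res_global.

End Restriction.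

(* Main.v *)
From mathcomp Require Import all_boot all_algebra.
From mathcomp Require Import finmap.
From mathcomp Require Import boolp classical_sets.
From mathcomp.multinomials Require Import monalg.
Require Import Defs.

Set Implicit Arguments.
Unset Strict Implicit.
Unset Printing Implicit Defensive.

Import GRing.Theory.

Local Open Scope classical_set_scope.
Local Open Scope ring_scope.

(** Primeness is tested on elements: a nonzero ring R, with or without a unit,
is prime if and only if x R y = 0 forces x = 0 or y = 0 ([prime_ringP]).

Write R for the skew groupoid ring and S_e for the skew group ring at e. The map
[corner] identifies S_e with the subring of R of the elements supported on the
isotropy group G_e^e; when A_e has an identity 1_e, this is the corner
(1_e delta_e) R (1_e delta_e).

If R is prime, some A_e is nonzero. For x, y in S_e, a product x (a delta_g) y
computed in R vanishes unless g lies in G_e^e ([corner_sandwich0]), so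
x S_e y = 0 implies x R y = 0, and the element criterion passes from R to S_e.

Conversely, let S_e be prime. The key point ([compress_neq0]) is that every
nonzero x in R can be moved into the corner at e without being killed:
connectedness gives morphisms p and q with p g q in G_e^e, where g is in the
support of x, and s-unitality gives coefficients c and d such that
(c delta_p) x (d delta_q), which lies in S_e, has the nonzero coefficient
sigma_p(x_g) at p g q. If x R y = 0 with x and y nonzero, then their
compressions z = u x v and t = u' y v' are nonzero elements of S_e with
z S_e t = 0, because z r t = u (x (v r u') y) v'; this contradicts the primeness
of S_e. *)

(** * Primeness in terms of elements *)

Section PrimeRings.
Variable R : rngType.
Implicit Types (x y z : R) (I J : set R).

Lemma rmulNr x y : x ** (- y) = - (x ** y).
Proof. by apply: (addrI (x ** y)); rewrite -rmulDr !subrr rmul0r. Qed.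

Lemma rmulNl x y : (- x) ** y = - (x ** y).
Proof. by apply: (addrI (x ** y)); rewrite -rmulDl !subrr rmul0l. Qed.

Lemma ideal_prod_eq0 I J : is_ideal I -> is_ideal J ->
  (forall x y, I x -> J y -> x ** y = 0) -> ideal_prod I J = [set 0].
Proof.
move=> [_ [I0 _] _] [_ [J0 _] _] IJ0; apply/seteqP; split=> z /=.
  by move=> [n [a [b [Ia Jb ->]]]]; apply: big1 => i _; apply: IJ0.
move=> ->; exists 0, (fun=> 0), (fun=> 0); split=> //.
by rewrite big_ord0.
Qed.

Lemma prime_ideals I J : prime_ring R -> is_ideal I -> is_ideal J ->
  (forall x y, I x -> J y -> x ** y = 0) ->
  (forall x, I x -> x = 0) \/ (forall y, J y -> y = 0).
Proof.
move=> [_ nIJ] iI iJ IJ0.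
have [I0|/eqP I0] := eqVneq I [set 0]; first by left=> x; rewrite I0.
have [J0|/eqP J0] := eqVneq J [set 0]; first by right=> y; rewrite J0.
by case: nIJ; exists I, J; split=> //; apply: ideal_prod_eq0.
Qed.

(** The elements z with R z = 0 form an ideal of square zero. In the element
criterion this takes over the role of a unit. *)
Lemma prime_rann0 y : prime_ring R -> (forall r, r ** y = 0) -> y = 0.
Proof.
move=> pR y0; pose L : set R := [set z | forall r, r ** z = 0].
have iL : is_ideal L.
  split=> //; first split=> [r|z w Lz Lw r]; first exact: rmul0r.
    by rewrite rmulDr rmulNr Lz Lw subrr.
  by move=> r z _ Lz; split=> t; rewrite ?rmulA Lz ?rmul0l.
have LL x z : L x -> L z -> x ** z = 0 by move=> _; apply.
by case: (prime_ideals pR iL iL LL); apply.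
Qed.

(** When x R y = 0 with y nonzero, annihilators turn x and y into ideals. To get
an honest product of ideals that is zero, rather than I R J = 0, y is first
replaced by a nonzero multiple t y, for which x (t y) = 0 holds as well. *)
Lemma prime_ringP : prime_ring R <->
  nonzero_ring R /\
  forall x y, (forall r, x ** r ** y = 0) -> x = 0 \/ y = 0.
Proof.
split=> [pR|[nzR elR]]; last first.
  split=> // -[I [J [iI iJ nI nJ IJ0]]].
  have nz (K : set R) : is_ideal K -> K <> [set 0] -> exists2 x, K x & x <> 0.
    move=> [_ [K0 _] _] nK; apply: contrapT => nex; apply: nK.
    apply/seteqP; split=> [x Kx|x ->//]; apply: contrapT => x0.
    by apply: nex; exists x.
  have [[x Ix nx] [y Jy ny]] := (nz _ iI nI, nz _ iJ nJ).
  suff /elR[] : forall r, x ** r ** y = 0 by [].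
  move=> r; have [_ _ Im] := iI.
  suff : ideal_prod I J (x ** r ** y) by rewrite IJ0.
  exists 1, (fun=> x ** r), (fun=> y); split=> // [_|]; last by rewrite big_ord1.
  by have [] := Im r x Logic.I Ix.
split; first by case: pR.
move=> x y xy0; have [->|/eqP ny] := eqVneq y 0; [by right | left].
have [t nty] : exists t, t ** y <> 0.
  by apply: contrapT => /forallNP nt; apply/ny/(prime_rann0 pR) => r; apply: contrapT.
(* I is the largest ideal that annihilates t y, and J its right annihilator. *)
pose I : set R := [set z | z ** (t ** y) = 0 /\ forall r, z ** r ** (t ** y) = 0].
pose J : set R := [set w | forall z, I z -> z ** w = 0].
have Ir z r : I z -> I (z ** r).
  by move=> [_ zy]; split=> // r'; rewrite -[z ** r ** r']rmulA.
have iI : is_ideal I.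
  split=> //; first split.
  - by split=> [|r]; rewrite !rmul0l.
  - move=> z w [z1 z2] [w1 w2].
    by split=> [|r]; rewrite !rmulDl !rmulNl ?z1 ?w1 ?z2 ?w2 subrr.
  move=> r z _ Iz; split; last exact: Ir.
  case: Iz => z1 z2; split=> [|r']; first by rewrite -rmulA z1 rmul0r.
  by rewrite -!rmulA [z ** _]rmulA z2 rmul0r.
have iJ : is_ideal J.
  split=> //; first split.
  - by move=> z _; rewrite rmul0r.
  - by move=> v w Jv Jw z Iz; rewrite rmulDr rmulNr Jv ?Jw ?subrr.
  move=> r w _ Jw; split=> z Iz; rewrite rmulA; first by apply/Jw/Ir.
  by rewrite Jw ?rmul0l.
have Ix : I x by split=> [|r]; rewrite rmulA ?xy0 // -[x ** r ** t]rmulA xy0.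
have Jty : J (t ** y) by move=> z [].
case: (prime_ideals pR iI iJ (fun z w Iz Jw => Jw z Iz)) => [|J0]; first exact.
by case: nty; apply: J0.
Qed.

End PrimeRings.

(** * The skew group ring at an object as a corner of the skew groupoid ring *)

Section Corner.
Variables (G : groupoidType) (A : rngType) (s : globalAction G A).
Variable e : object G.

Local Notation Ae := (ideal_ring (component s e)).
Local Notation Se := (skew_ring (restriction s e)).
Local Notation R := (skew_ring s).

(** Extension by zero from the isotropy group at e to G. *)
Definition corner_malg (x : {malg Ae[isotropy e]}) : {malg A[G]} :=
  \sum_(g <- msupp x) << val x@_g *g val g >>.

Lemma mcoeff_corner x g : (corner_malg x)@_(val g) = val x@_g.
Proof.
rewrite /corner_malg raddf_sum /=.
have [gx|/mcoeff_outdom xg] := boolP (g \in msupp x); last first.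
  rewrite xg big1 //= => h _; rewrite mcoeffU.
  have [/val_inj eqhg|] := eqVneq (val h) (val g); last by rewrite mulr0n.
  by rewrite eqhg xg mul0rn.
rewrite (big_fsetD1 g) //= mcoeffUU big1_seq ?addr0 //= => h.
rewrite !inE => /andP[nhg _]; rewrite mcoeffU.
by rewrite (inj_eq val_inj) (negbTE nhg).
Qed.

Lemma mcoeff_corner0 x k : ~~ in_isotropy e k -> (corner_malg x)@_k = 0.
Proof.
move=> nk; rewrite /corner_malg raddf_sum /= big1 // => g _; rewrite mcoeffU.
case: eqP => // gk; rewrite -gk in nk; by case/negP: nk; apply: iso_valP.
Qed.


Lemma corner_mem x : corner_malg x \in skew_pred s.
Proof.
apply/skewP => k; have [ik|/mcoeff_corner0->] := boolP (in_isotropy e k).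
  rewrite -[k]/(val (Isotropy ik)) mcoeff_corner iso_dom; exact: Ae_dom.
exact: dom0.
Qed.

Lemma restriction_mem x : x \in skew_pred (restriction s e).
Proof. by apply/skewP => g; rewrite [dom _ _]res_domT. Qed.

Lemma corner_malgU a g : corner_malg << a *g g >> = << val a *g val g >>.
Proof.
apply/malgP => k; have [ik|nk] := boolP (in_isotropy e k).
  rewrite -[k]/(val (Isotropy ik)) mcoeff_corner !mcoeffU (inj_eq val_inj).
  by case: eqP.
rewrite mcoeff_corner0 // mcoeffU; case: eqP => // gk.
by case/negP: nk; rewrite -gk; apply: iso_valP.
Qed.

Lemma corner_malgD x y : corner_malg (x + y) = corner_malg x + corner_malg y.
Proof.
apply/malgP => k; rewrite mcoeffD; have [ik|nk] := boolP (in_isotropy e k).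
  by rewrite -[k]/(val (Isotropy ik)) !mcoeff_corner mcoeffD.
by rewrite !mcoeff_corner0 // addr0.
Qed.

Lemma corner_malg0 : corner_malg 0 = 0.
Proof. by rewrite /corner_malg msupp0 big_seq_fset0. Qed.

Lemma corner_malgM x y :
  corner_malg (skew_prod (restriction s e) x y) =
  skew_prod s (corner_malg x) (corner_malg y).
Proof.
have := restriction_mem x; elim/skew_ind => {x} [|g a x _ _ IHx].
  by rewrite skew_prod0l corner_malg0 skew_prod0l.
rewrite corner_malgD !skew_prodDl corner_malgD IHx; congr (_ + _) => {x IHx}.
have := restriction_mem y; elim/skew_ind => {y} [|h b y _ _ IHy].
  by rewrite skew_prod0r corner_malg0 skew_prod0r.
rewrite skew_prodDr ?restriction_mem // !corner_malgD IHy.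
rewrite skew_prodDr ?corner_mem //; congr (_ + _) => {y IHy}.
rewrite skew_prodU !corner_malgU skew_prodU (iso_srctgt g h) eqxx.
case: eqP => [_|[]]; first by rewrite corner_malgU.
exact/val_inj/iso_srctgt.
Qed.

Definition corner (x : Se) : R := SkewRing (corner_mem (val x)).

Lemma cornerM x y : corner (x ** y) = corner x ** corner y.
Proof. exact/val_inj/corner_malgM. Qed.

Lemma corner_eq0 x : corner x = 0 -> x = 0.
Proof.
move=> /(congr1 val) /= x0; apply/val_inj/malgP => g; apply: val_inj.
by rewrite /= -mcoeff_corner x0 !mcoeff0.
Qed.

Lemma corner0 : corner 0 = 0.
Proof. exact/val_inj/corner_malg0. Qed.

Lemma corner_mono g a : dom s g a -> in_isotropy e g ->
  exists z, corner_malg z = << a *g g >>.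
Proof.
move=> da ig; have aI : a \in ideal_pred (component s e).
  by apply/asboolP; rewrite /= -(iso_dom s (Isotropy ig)).
by exists << IdealRing aI *g Isotropy ig >>; rewrite corner_malgU.
Qed.

(** The support of [corner_malg x] and [corner_malg y] lies in the isotropy group,
so that a product through k is composable only if k is a loop at e. *)
Lemma corner_sandwich0 x y k a : ~~ in_isotropy e k -> dom s k a ->
  skew_prod s (skew_prod s (corner_malg x) << a *g k >>) (corner_malg y) = 0.
Proof.
move=> nk dk; have mk := skew_monoP dk.
have := restriction_mem x; elim/skew_ind => {x} [|g b x _ _ IHx].
  by rewrite corner_malg0 !skew_prod0l.
rewrite corner_malgD !skew_prodDl IHx addr0 corner_malgU skew_prodU => {x IHx}.
case: eqP => [gk|_]; last by rewrite skew_prod0l.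
have := restriction_mem y; elim/skew_ind => {y} [|h c y _ _ IHy].
  by rewrite corner_malg0 !skew_prod0r.
rewrite corner_malgD skew_prodDr ?corner_mem // IHy addr0 corner_malgU.
rewrite skew_prodU gsrc_comp // => {y IHy}; case: eqP => // kh.
by case/negP: nk; rewrite /in_isotropy kh -gk iso_src iso_tgt eqxx.
Qed.

(** Compression: multiplying by a monomial with target e on the left and one with
source e on the right leaves only loops at e in the support. *)
Lemma skew_corner p q c d (x : {malg A[G]}) :
  gtgt p = val e -> gsrc q = val e -> dom s p c -> dom s q d ->
  x \in skew_pred s ->
  exists z, corner_malg z = skew_prod s (skew_prod s << c *g p >> x) << d *g q >>.
Proof.
move=> pe qe dc dd; have [mc md] := (skew_monoP dc, skew_monoP dd).
elim/skew_ind => {x} [|k a x da sx [z zE]].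
  by exists 0; rewrite corner_malg0 skew_prod0r skew_prod0l.
have ma := skew_monoP da; rewrite skew_prodDr // skew_prodDl -zE.
suff [t <-] : exists t, corner_malg t =
    skew_prod s (skew_prod s << c *g p >> << a *g k >>) << d *g q >>.
  by exists (t + z); rewrite corner_malgD.
have Pm := skew_prod_closed (skew_prod_closed mc ma) md.
move: Pm; rewrite skew_prodU; case: eqP => [pk|_]; last first.
  by exists 0; rewrite corner_malg0 skew_prod0l.
rewrite skew_prodU gsrc_comp //; case: eqP => [kq|_]; last first.
  by exists 0; rewrite corner_malg0.
move=> /skewP /(_ (gcomp (gcomp p k) q)); rewrite mcoeffUU => dm.
apply: corner_mono dm _; rewrite /in_isotropy gsrc_comp ?gtgt_comp ?gsrc_comp //.
by rewrite pe qe eqxx.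
Qed.

End Corner.

(** * Compressing a nonzero element to a nonzero element of a corner *)

Section Compression.
Variables (G : groupoidType) (A : rngType) (s : globalAction G A).

Lemma gcompKg (g h : G) : gsrc g = gtgt h -> gcomp (ginv g) (gcomp g h) = h.
Proof. by move=> gh; rewrite gcompA ?gsrc_inv // gcompVg gh gcomp_tgt. Qed.

Lemma gcompgK (g h : G) : gsrc g = gtgt h -> gcomp (gcomp g h) (ginv h) = g.
Proof. by move=> gh; rewrite -gcompA ?gtgt_inv // gcompgV -gh gcomp_src. Qed.

(** By cancellation in G, only g contributes to the coefficient at p g. *)
Lemma mcoeff_skew_mulUl p c g x : gsrc p = gtgt g -> x \in skew_pred s ->
  dom s p c ->
  (skew_prod s << c *g p >> x)@_(gcomp p g) = c ** act s p x@_g.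
Proof.
move=> pg sx dc; elim/skew_ind: x / sx => [|k a x da sx IHx].
  by rewrite skew_prod0r !mcoeff0 act0 rmul0r.
have sa := skew_monoP da.
have dg y : y \in skew_pred s -> dom s (ginv p) y@_g.
  by move=> /skewP; rewrite (dom_srctgt _ pg).
rewrite skew_prodDr // !mcoeffD (actD (dg _ sa) (dg _ sx)) rmulDr IHx.
congr (_ + _).
rewrite skew_prodU; case: eqP => [pk|npk].
  rewrite !mcoeffU; have [<-|nkg] := eqVneq k g; first by rewrite eqxx.
  case: eqP => [pkg|_]; last by rewrite act0 rmul0r.
  by move: nkg; rewrite -(gcompKg pk) pkg gcompKg ?eqxx.
rewrite mcoeff0 mcoeffU; case: eqP => [kg|_]; last by rewrite act0 rmul0r.
by case: npk; rewrite kg.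
Qed.

Lemma mcoeff_skew_mulUr q d g x : gsrc g = gtgt q ->  x \in skew_pred s ->
  (skew_prod s x << d *g q >>)@_(gcomp g q) = x@_g ** act s g d.
Proof.
move=> gq sx; elim/skew_ind: x / sx => [|k a x da sx IHx].
  by rewrite skew_prod0l !mcoeff0 rmul0l.
rewrite skew_prodDl !mcoeffD rmulDl IHx; congr (_ + _).
rewrite skew_prodU; case: eqP => [kq|nkq].
  rewrite !mcoeffU; have [<-|nkg] := eqVneq k g; first by rewrite eqxx.
  case: eqP => [kqg|_]; last by rewrite rmul0l.
  by move: nkg; rewrite -(gcompgK kq) kqg gcompgK ?eqxx.
rewrite mcoeff0 mcoeffU; case: eqP => [kg|_]; last by rewrite rmul0l.
by case: nkq; rewrite kg.
Qed.

Lemma dom_s_unital (e : object G) w : s_unital (ideal_ring (component s e)) ->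
  dom s (val e) w ->
  exists a b, [/\ dom s (val e) a, dom s (val e) b, a ** w = w & w ** b = w].
Proof.
move=> su dw; have wI : w \in ideal_pred (component s e) by apply/asboolP.
have [a [b [/(congr1 val) /= aw /(congr1 val) /= wb]]] := su (IdealRing wI).
by exists (val a), (val b); split; rewrite -?wb //; apply: Ae_dom.
Qed.

Lemma act_inj0 g x : dom s (ginv g) x -> act s g x = 0 -> x = 0.
Proof.
move=> dx gx; have [[_ inj _] _ _] := act_iso s g.
by apply: inj; rewrite ?act0 //; apply/mem_set => //; apply: dom0.
Qed.

Definition source_object (g : G) : object G :=
  exist _ (gsrc g) (introT eqP (gsrc_src g)).

(** For g in the support of x, choose p from the target of g to e and q from e to
the source of g. With local units c and b of w = sigma_p(x_g) in A_e, and
d = sigma_pg^-1(b), the coefficient of (c delta_p) x (d delta_q) at p g q is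
c w sigma_pg(d) = c w b = w. *)
Lemma compress_neq0 (e : object G) (x : skew_ring s) :
  s_unital (ideal_ring (component s e)) -> connected_groupoid G -> x <> 0 ->
  exists u v : skew_ring s, exists2 z : skew_ring (restriction s e),
    corner z = u ** x ** v & z <> 0.
Proof.
move=> su cG nx.
have [g ng] : exists g, (val x)@_g <> 0.
  apply: contrapT => /forallNP x0; apply/nx/val_inj/malgP => g.
  by rewrite mcoeff0; apply: contrapT.
have sx := skew_valP x; have /skewP/(_ g) dx := sx.
pose eg : object G := source_object g; pose fg := source_object (ginv g).
have [p [ps pt]] := cG fg e; have [q [qs qt]] := cG e eg.
rewrite /= gsrc_inv in ps; rewrite /= in qt.
have dpx : dom s (ginv p) (val x)@_g by rewrite (dom_srctgt s ps).
set w := act s p (val x)@_g.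
have nw : w <> 0 by move=> /(act_inj0 dpx).
have dp : dom s p = dom s (val e) by apply: dom_tgt; rewrite object_tgt.
have dw : dom s (val e) w by rewrite -dp; apply: act_dom.
have [c [b [dc db cw wb]]] := dom_s_unital su dw; rewrite -dp in dc.
have pgt : gtgt (gcomp p g) = gtgt (val e) by rewrite gtgt_comp // object_tgt.
have [[_ _ sur] _ _] := act_iso s (gcomp p g).
have [d dd sdb] : exists2 d, dom s (ginv (gcomp p g)) d & act s (gcomp p g) d = b.
  by have [|d dd sdb] := sur b; [rewrite (dom_tgt s pgt) | exists d].
rewrite (@dom_srctgt _ _ s _ q) ?gsrc_comp // in dd.
have [z0 z0E] := skew_corner pt qs dc dd sx.
exists (SkewRing (skew_monoP dc)), (SkewRing (skew_monoP dd)).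
exists (SkewRing (restriction_mem z0)); first exact: val_inj.
move=> /(congr1 (fun z => (val (corner z))@_(gcomp (gcomp p g) q))).
rewrite corner0 /= z0E mcoeff_skew_mulUr ?gsrc_comp //; last first.
  exact: skew_prod_closed (skew_monoP dc) sx.
by rewrite mcoeff_skew_mulUl // -/w cw sdb wb mcoeff0 => /nw.
Qed.

Lemma skew_nonzero (e : object G) :
  nonzero_ring (ideal_ring (component s e)) -> nonzero_ring (skew_ring s).
Proof.
move=> [a na]; exists (SkewRing (skew_monoP (Ae_dom a))).
move=> /(congr1 val) /= /malgP /(_ (val e)); rewrite mcoeffUU mcoeff0 => a0.
exact/na/val_inj.
Qed.

End Compression.

Theorem theorem4p21 (G : groupoidType) (A : rngType) (sigma : globalAction G A)
    (s_unital_components :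
       forall e : object G, s_unital (ideal_ring (component sigma e)))
    (A_direct_sum : internal_direct_sum sigma)
    (G_connected : connected_groupoid G) :
  prime_ring (skew_ring sigma) <->
  exists e : object G,
    nonzero_ring (ideal_ring (component sigma e)) /\
    prime_ring (skew_ring (restriction sigma e)).
Proof.
split=> [/prime_ringP[[x nx] elR]|[e [nzA /prime_ringP[nzS elS]]]]; last first.
  apply/prime_ringP; split; first exact: skew_nonzero nzA.
  move=> x y xy0; apply: contrapT => /not_orP[nx ny].
  have [u [v [z zE nz]]] := compress_neq0 (s_unital_components e) G_connected nx.
  have [u' [v' [t tE nt]]] :=
    compress_neq0 (s_unital_components e) G_connected ny.
  have [] // := elS z t => r; apply: corner_eq0; rewrite !cornerM zE tE.
  have -> : u ** x ** v ** corner r ** (u' ** y ** v') =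
            u ** (x ** (v ** corner r ** u') ** y) ** v' by rewrite !rmulA.
  by rewrite xy0 rmul0r rmul0l.
have [g ng] : exists g, (val x)@_g <> 0.
  apply: contrapT => /forallNP x0; apply/nx/val_inj/malgP => g.
  by rewrite mcoeff0; apply: contrapT.
(* The object at which A_e is nonzero is the target of g, which is the source of
   its inverse. *)
pose e := source_object (ginv g).
have nzA : nonzero_ring (ideal_ring (component sigma e)).
  have xI : (val x)@_g \in ideal_pred (component sigma e).
    apply/asboolP; rewrite /= gsrc_inv -dom_global.
    exact: (skewP _ _ (skew_valP x)).
  by exists (IdealRing xI) => /(congr1 val).
exists e; split=> //; apply/prime_ringP; split.
  have eI : in_isotropy e (val e) by rewrite /in_isotropy object_src object_tgt eqxx.
  have [a na] := nzA.
  exists (SkewRing (restriction_mem << a *g Isotropy eI >>)).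
  move=> /(congr1 val) /= /malgP /(_ (Isotropy eI)).
  by rewrite mcoeffUU mcoeff0.
move=> z t zt0; suff /elR[] : forall r, corner z ** r ** corner t = 0.
- by move=> /corner_eq0; left.
- by move=> /corner_eq0; right.
move=> r; apply: val_inj; rewrite /=.
elim/skew_ind: {r}(val r) / (skew_valP r) => [|k a r da sr IHr].
  by rewrite skew_prod0r skew_prod0l.
rewrite skew_prodDr ?skew_monoP // skew_prodDl IHr addr0.
have [ik|nk] := boolP (in_isotropy e k); last exact: corner_sandwich0.
have [w <-] := corner_mono da ik.
have /(congr1 (@corner _ _ _ _)) := zt0 (SkewRing (restriction_mem w)).
by rewrite !cornerM corner0 => /(congr1 val).
Qed.
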